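(* Let $a > 0$ and, for each $\theta \ge 1$, consider the scalar decomposed-dynamics problem with dynamics $\dot x = a x + b u$, where the task parameter $b$ ranges over $\mathbf{B}_\theta = [\frac{1}{\theta}, 1]$ (so $\mathbf{A} = \{a\}$). If $\alpha \geq \frac{2a+1}{2a}$, then the $\alpha$-suboptimal covering number satisfies $N_\alpha(\mathbf{B}_\theta) = O(\log \theta)$ as $\theta \to \infty$, with $a$ and $\alpha$ fixed.
   Context: Scalar problem: the state space is $\mathbb{R}$ and the action space is $\mathbb{R}$. For a task $b$ and a policy $\pi : \mathbb{R} \to \mathbb{R}$, the cost is $$J_b(\pi) = \mathbb{E}_{x(0) \sim \mathcal{N}(0,1)} \int_0^\infty \big(x(t)^2 + u(t)^2\big)\,dt,$$ where $\dot x = a x + b u$ and $u = \pi(x)$. The cost may equal $+\infty$, and we set $J_b(\pi) = +\infty$ whenever the closed-loop system does not define a global trajectory. Reference policies are the linear ones, $\pi(x) = kx$ with $k \in \mathbb{R}$, and $J^\star_b = \min_{k \in \mathbb{R}} J_b(k)$, where $J_b(k)$ denotes the cost of $u = kx$. For $\alpha > 1$, the $\alpha$-suboptimal neighborhood of a policy $\pi$ is $\mathscr{N}_\alpha(\pi) = \{ b \in \mathbf{B}_\theta : J_b(\pi)/J^\star_b \leq \alpha\}$. A set $\mathcal{C}$ of policies $\mathbb{R} \to \mathbb{R}$ is an $\alpha$-suboptimal cover of $\mathbf{B}_\theta$ if $\bigcup_{\pi \in \mathcal{C}} \mathscr{N}_\alpha(\pi) = \mathbf{B}_\theta$. The covering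 number $N_\alpha(\mathbf{B}_\theta)$ is the size of the smallest finite $\alpha$-suboptimal cover if one exists, and $\infty$ otherwise. *)

(* Defs.v *)
From HB Require Import structures.
From mathcomp Require Import all_boot all_order all_algebra.
From mathcomp Require Import all_classical all_reals all_analysis.
Set Implicit Arguments.
Unset Strict Implicit.
Unset Printing Implicit Defensive.
Import Order.TTheory GRing.Theory Num.Theory numFieldNormedType.Exports.
Local Open Scope classical_set_scope.
Local Open Scope ring_scope.

(* A trajectory is represented by a function on the whole line of which only
   the values at t >= 0 matter.  The values at t < 0 being free, the two-sided
   derivative at t = 0 asks no more than a right derivative. *)
Definition is_trajectory {R : realType} (a b : R) (pi : R -> R) (x0 : R)
    (x : R -> R) : Prop :=
  x 0 = x0 /\
  forall t : R, 0 <= t -> is_derive t (1 : R) x (a * x t + b * pi (x t)).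

Definition globally_defined {R : realType} (a b : R) (pi : R -> R) : Prop :=
  forall x0 : R,
    (exists x, is_trajectory a b pi x0 x) /\
    (forall x y, is_trajectory a b pi x0 x -> is_trajectory a b pi x0 y ->
       forall t, 0 <= t -> x t = y t).

(* Junk value 0 when there is no trajectory from x0. *)
Definition trajectory {R : realType} (a b : R) (pi : R -> R) (x0 : R)
    : R -> R :=
  xget (cst 0) [set x | is_trajectory a b pi x0 x].

(* When globally_defined holds, no measurability assumption is missing: the
   trajectory is nondecreasing in x0 and continuous in t, and the input is a
   pointwise limit of difference quotients of the trajectory, so the integrands
   below are measurable. *)
Definition cost {R : realType} (a b : R) (pi : R -> R) : \bar R :=
  if `[< globally_defined a b pi >] then
    (\int[normal_prob 0 1]_x0
      \int[lebesgue_measure]_(t in `[0%R, +oo[)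
        (trajectory a b pi x0 t ^+ 2 + pi (trajectory a b pi x0 t) ^+ 2)%:E)%E
  else +oo%E.

Definition linear_policy {R : realType} (k : R) : R -> R := fun x => k * x.

(* The minimum over k, which is attained when b != 0. *)
Definition opt_cost {R : realType} (a b : R) : \bar R :=
  ereal_inf [set cost a b (linear_policy k) | k in [set: R]].

Definition tasks {R : realType} (theta : R) : set R := `[theta^-1, 1].

Definition subopt_nbhd {R : realType} (a alpha theta : R) (pi : R -> R)
    : set R :=
  [set b | tasks theta b /\ (cost a b pi / opt_cost a b <= alpha%:E)%E].

Definition subopt_cover {R : realType} (a alpha theta : R)
    (C : set (R -> R)) : Prop :=
  \bigcup_(pi in C) subopt_nbhd a alpha theta pi = tasks theta.

(* A set of sizes, so the infimum is a minimum, or +oo without finite cover. *)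
Definition covering_number {R : realType} (a alpha theta : R) : \bar R :=
  ereal_inf [set n%:R%:E | n in
    [set n : nat | exists C : set (R -> R),
       (C #= `I_n)%card /\ subopt_cover a alpha theta C]].

(* Main.v *)
Require Import Defs.
From mathcomp Require Import all_boot all_order all_algebra.
From mathcomp Require Import all_classical all_reals all_analysis.
From mathcomp Require Import measurable_realfun ring lra.
Import Order.TTheory GRing.Theory Num.Theory numFieldNormedType.Exports.
Local Open Scope classical_set_scope.
Local Open Scope ring_scope.

(** For a linear policy [k] the closed loop is x' = c x with c = a + b k, so
every trajectory is x0 exp(c t).  Its cost is therefore a number that depends on
[k] alone, times the second moment V of the initial state: V (1 + k^2) / (-2 c)
when c < 0, and +oo when c >= 0 ([cost_linear_stable], [cost_linear_unstable]).
Completing the square around k = - b p, where p is the positive root of the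
Riccati equation b^2 p^2 = 2 a p + 1, shows that the optimal cost is V p
([opt_costE]).

Let p0 and p be these roots for gains b0 <= b <= s b0.  The policy optimal for
b0 stabilizes b too: a larger gain only makes the loop more stable, so the cost
of this policy on b is at most its cost V p0 on b0.  Since
p = (a + sqrt (a^2 + b^2)) / b^2, raising the gain from b0 to b divides the
optimal cost by at most (b / b0)^2 <= s^2.  Hence one policy is s^2-suboptimal
on the whole interval [b0, s b0] ([subopt_ratio]), whatever the scale b0.

The hypothesis on alpha gives alpha > 1.  With s = sqrt alpha, geometrically
spaced intervals of ratio s cover [1/theta, 1], and about
ln theta / ln s of them suffice, which is linear in ln theta. *)

Set Implicit Arguments.
Unset Strict Implicit.
Unset Printing Implicit Defensive.

(** * The second moment of a normal law *)

Section normal_moment.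
Context {R : realType}.
Local Notation mu := (@lebesgue_measure R).

(** The normal density is a Radon-Nikodym derivative of the normal law, and such
a derivative is unique almost everywhere. *)
Lemma integral_normal_prob (m s : R) (f : R -> \bar R) :
  (forall x, 0 <= f x)%E -> measurable_fun [set: R] f ->
  (\int[normal_prob m s]_x f x =
   \int[mu]_x (f x * (normal_pdf m s x)%:E))%E.
Proof.
move=> f0 mf.
have dom := normal_prob_dominates m s.
rewrite -(Radon_Nikodym_SigmaFinite.change_of_variables dom)//.
have intd := Radon_Nikodym_SigmaFinite.f_integrable dom.
apply: ae_eq_integral => //.
- by apply: emeasurable_funM => //; exact: measurable_int intd.
- apply: emeasurable_funM => //; apply/measurable_EFinP.
  exact: measurable_normal_pdf.
- apply: ae_eqe_mul2l; apply: integral_ae_eq => //.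
  + by apply/measurable_EFinP; exact: measurable_normal_pdf.
  + by move=> E _ mE; rewrite -Radon_Nikodym_SigmaFinite.f_integral.
Qed.

Local Notation V := (\int[normal_prob 0 1]_x ((x : R) ^+ 2)%:E)%E.

(** A zero second moment would concentrate the law on the origin, but a law with
a density gives no mass to a point. *)
Lemma normal_second_moment_gt0 : (0 < V)%E.
Proof.
rewrite lt0e integral_ge0 ?andbT; last by move=> x _; rewrite lee_fin sqr_ge0.
apply/eqP => V0.
have msq : measurable_fun setT (fun x : R => (x ^+ 2)%:E).
  by apply/measurable_EFinP; exact: measurable_funX.
have abs0 : (\int[normal_prob 0 1]_x `|((x : R) ^+ 2)%:E| = 0)%E.
  rewrite -V0; apply: eq_integral => x _.
  by rewrite gee0_abs// lee_fin sqr_ge0.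
have [+ _] := @ae_eq_integral_abs _ _ R (normal_prob 0 1) _ measurableT
  (fun x : R => (x ^+ 2)%:E) msq.
move=> /(_ abs0)[N [mN N0 subN]].
have P0 : normal_prob (0 : R) 1 [set 0] = 0%E.
  apply: (proj1 (null_content_dominatesP _ _) (normal_prob_dominates 0 1)) => //.
  exact: lebesgue_measure_set1.
have : (normal_prob (0 : R) 1 setT <= 0)%E.
  rewrite -[leRHS]adde0 -{1}N0 -P0.
  apply: (le_trans _ (measureU2 _ _ _)) => //.
  apply: le_measure; rewrite ?inE//; first exact: measurableU.
  move=> x _; have [->|x0] := eqVneq x 0; first by right.
  left; apply: subN => /= /(_ I)[]/eqP; rewrite sqrf_eq0.
  by apply/negP.
by rewrite probability_setT lee_fin ler10.
Qed.

(** Half of the Gaussian decay absorbs the square: x^2 exp(- x^2 / 4) <= 4, and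
what remains is proportional to the density of the normal law of variance 2. *)
Lemma normal_second_moment_lty : (V < +oo)%E.
Proof.
have s2 : Num.sqrt 2 != 0 :> R by rewrite sqrtr_eq0 -ltNge.
(* 4 bounds x^2 exp(- x^2 / 4); the two peaks normalize the densities. *)
pose C : R := 4 * normal_peak 1 / normal_peak (Num.sqrt 2).
have C0 : 0 <= C by rewrite /C divr_ge0 ?mulr_ge0 ?normal_peak_ge0.
rewrite integral_normal_prob; last 2 first.
  by move=> x; rewrite lee_fin sqr_ge0.
  by apply/measurable_EFinP; exact: measurable_funX.
apply: (@le_lt_trans _ _
    (\int[mu]_x (C%:E * (normal_pdf 0 (Num.sqrt 2) x)%:E))%E).
  apply: ge0_le_integral => //.
  - by move=> x _; rewrite -EFinM lee_fin mulr_ge0 ?sqr_ge0 ?normal_pdf_ge0.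
  - apply/measurable_EFinP; apply: measurable_funM.
      exact: measurable_funX.
    exact: measurable_normal_pdf.
  - apply/measurable_EFinP; apply: measurable_funM => //.
    exact: measurable_normal_pdf.
  - move=> x _; rewrite -!EFinM lee_fin /normal_pdf oner_eq0 (negbTE s2).
    rewrite /normal_fun subr0 sqr_sqrtr// expr1n.
    have -> : - x ^+ 2 / (1 *+ 2) = (- x ^+ 2 / 4) + (- x ^+ 2 / (2 *+ 2)) :> R.
      by field.
    rewrite expRD /C.
    set e := expR (- x ^+ 2 / (2 *+ 2)).
    have e0 : 0 <= e by exact: expR_ge0.
    have p2 := normal_peak_gt0 s2.
    have p1 := normal_peak_ge0 (1 : R).
    have -> : 4 * normal_peak 1 / normal_peak (Num.sqrt 2) *
        (normal_peak (Num.sqrt 2) * e) = normal_peak 1 * e * 4.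
      by field; rewrite gt_eqF.
    have -> : x ^+ 2 * (normal_peak 1 * (expR (- x ^+ 2 / 4) * e)) =
        normal_peak 1 * e * (x ^+ 2 * expR (- x ^+ 2 / 4)) by ring.
    rewrite ler_wpM2l ?mulr_ge0// mulNr expRN -ler_pdivlMr ?invr_gt0 ?expR_gt0//.
    rewrite invrK; have := expR_ge1Dx (x ^+ 2 / 4); lra.
rewrite ge0_integralZl_EFin//=.
- by rewrite integral_normal_pdf// mule1 ltry.
- by move=> x _; rewrite lee_fin normal_pdf_ge0.
- by apply/measurable_EFinP; exact: measurable_normal_pdf.
Qed.

End normal_moment.

(** * Cost of a linear policy *)

Section linear_policy_cost.
Context {R : realType}.
Implicit Types a b k : R.

Lemma is_trajectory_linear a b k x0 :
  is_trajectory a b (linear_policy k) x0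
    (fun t => x0 * expR ((a + b * k) * t)).
Proof.
split; first by rewrite mulr0 expR0 mulr1.
move=> t _; rewrite /linear_policy.
apply: is_derive_eq; rewrite /GRing.scale/=; ring.
Qed.

(** Multiplying a trajectory by the integrating factor exp(- c t) makes it
constant, by the mean value theorem on [0, t]: the differential equation is known
for nonnegative times only. *)
Lemma trajectory_linear_unique a b k x0 x :
  is_trajectory a b (linear_policy k) x0 x ->
  forall t : R, 0 <= t -> x t = x0 * expR ((a + b * k) * t).
Proof.
move=> [x00 dx] t t0; set c := a + b * k.
pose g s := x s * expR (- c * s).
have dg (s : R) : 0 <= s -> is_derive s 1 g 0.
  move=> s0; have := dx s s0; rewrite /linear_policy => dxs.
  apply: is_derive_eq; rewrite /GRing.scale/= /c; ring.
have [||s _] := @MVT_segment R g (fun=> 0) 0 t t0.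
- by move=> s; rewrite in_itv/= => /andP[/ltW s0 _]; exact: dg.
- apply: derivable_within_continuous => s; rewrite in_itv/= => /andP[s0 _].
  by have [] := dg s s0.
rewrite mul0r => /subr0_eq.
rewrite /g mulr0 expR0 mulr1 x00 => <-.
by rewrite -mulrA -expRD mulNr addNr expR0 mulr1.
Qed.

Lemma globally_defined_linear a b k : globally_defined a b (linear_policy k).
Proof.
move=> x0; split; first by eexists; exact: is_trajectory_linear.
by move=> x y hx hy t t0; rewrite !(trajectory_linear_unique hx, trajectory_linear_unique hy).
Qed.

Lemma trajectory_linearE a b k x0 t : 0 <= t ->
  trajectory a b (linear_policy k) x0 t = x0 * expR ((a + b * k) * t).
Proof.
apply: trajectory_linear_unique.
by apply: xgetPex; eexists; exact: is_trajectory_linear.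
Qed.

(** The initial state enters only through the factor x0^2, so the expectation
splits off. *)
Lemma cost_linearE a b k :
  cost a b (linear_policy k) =
  (\int[normal_prob 0 1]_x0 ((x0 : R) ^+ 2)%:E *
   \int[lebesgue_measure]_(t in `[0%R, +oo[)
     ((1 + k ^+ 2) * expR (2 * (a + b * k) * t))%:E)%E.
Proof.
rewrite /cost asboolT; last exact: globally_defined_linear.
rewrite -ge0_integralZr//; last 3 first.
- by apply/measurable_EFinP; exact: measurable_funX.
- by move=> x _; rewrite lee_fin sqr_ge0.
- by apply: integral_ge0 => t _; rewrite lee_fin mulr_ge0 ?expR_ge0 ?addr_ge0 ?sqr_ge0.
apply: eq_integral => x0 _.
rewrite -ge0_integralZl_EFin//; last 3 first.
- by move=> t _; rewrite lee_fin mulr_ge0 ?expR_ge0 ?addr_ge0 ?sqr_ge0.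
- apply/measurable_EFinP/measurable_funTS; apply: measurable_funM => //.
  by apply: measurableT_comp => //; exact: measurable_funM.
- exact: sqr_ge0.
apply: eq_integral => t; rewrite inE/= in_itv/= andbT => t0.
rewrite -EFinM; congr _%:E.
rewrite trajectory_linearE// /linear_policy.
have -> : 2 * (a + b * k) * t = (a + b * k) * t + (a + b * k) * t by ring.
rewrite expRD; ring.
Qed.

Lemma integral_expR_decay (C r : R) : 0 <= C -> 0 < r ->
  (\int[lebesgue_measure]_(t in `[0%R, +oo[) (C * expR (- r * t))%:E =
   (C / r)%:E)%E.
Proof.
move=> C0 r0.
have dF (t : R) : is_derive t (1:R) (fun t => - (C / r) * expR (- r * t)) (C * expR (- r * t)).
  apply: is_derive_eq; rewrite /GRing.scale/=; field; by rewrite gt_eqF.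
have cF : continuous (fun t : R => - (C / r) * expR (- r * t)).
  by move=> t; apply: differentiable_continuous; apply/derivable1_diffP; have [] := dF t.
rewrite (@ge0_continuous_FTC2y _ _
  (fun t => - (C / r) * expR (- r * t)) _ 0)//.
- by rewrite mulr0 expR0 mulr1 EFinN oppeK add0e.
- by move=> t _; rewrite mulr_ge0 ?expR_ge0.
- apply: continuous_subspaceT => t.
  by apply: differentiable_continuous; apply/derivable1_diffP; exact: ex_derive.
- rewrite -[0](mulr0 (- (C / r))); apply: cvgMr.
  rewrite (_ : (fun x => expR (- r * x)) =
               (fun z => expR (- z)) \o (fun z => r * z)); last first.
    by apply: eq_fun => x; rewrite mulNr.
  apply: (@cvg_comp _ _ _ _ _ _ (pinfty_nbhs R)); last exact: cvgr_expR.
  exact: gt0_cvgMry.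
- by apply: cvg_at_right_filter; exact: cF.
- by move=> t _; rewrite derive1E; have [_ ->] := dF t.
Qed.

Lemma cost_linear_stable a b k : a + b * k < 0 ->
  cost a b (linear_policy k) =
  (\int[normal_prob 0 1]_x0 ((x0 : R) ^+ 2)%:E *
   ((1 + k ^+ 2) / (- 2 * (a + b * k)))%:E)%E.
Proof.
move=> c0; rewrite cost_linearE -integral_expR_decay; last 2 first.
- by rewrite addr_ge0 ?sqr_ge0.
- by rewrite mulNr -mulrN mulr_gt0// oppr_gt0.
by congr (_ * _)%E; apply: eq_integral => t _; rewrite !mulNr opprK.
Qed.

Lemma cost_linear_unstable a b k : 0 <= a + b * k ->
  cost a b (linear_policy k) = +oo%E.
Proof.
move=> c0; rewrite cost_linearE.
suff -> : (\int[lebesgue_measure]_(t in `[0%R, +oo[)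
    ((1 + k ^+ 2) * expR (2 * (a + b * k) * t))%:E)%E = +oo%E.
  by rewrite gt0_muley// normal_second_moment_gt0.
apply/eqP; rewrite -leye_eq.
have <- : (\int[lebesgue_measure]_(t in `[0%R, +oo[) (1 : R)%:E)%E = +oo%E.
  by rewrite integral_cst//= mul1e lebesgue_measure_itv/= ltry.
apply: ge0_le_integral => //.
- apply/measurable_EFinP/measurable_funTS; apply: measurable_funM => //.
  by apply: measurableT_comp => //; exact: measurable_funM.
- move=> t; rewrite /= in_itv/= andbT => t0; rewrite lee_fin -[leLHS]mulr1.
  apply: ler_pM => //; first by rewrite lerDl sqr_ge0.
  by rewrite -expR0 ler_expR !mulr_ge0.
Qed.

End linear_policy_cost.

(** * Optimal cost and suboptimality ratios *)

Section optimal_cost.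
Context {R : realType}.
Local Notation V := (\int[normal_prob 0 1]_x ((x : R) ^+ 2)%:E)%E.

(** The positive root p of the scalar Riccati equation b^2 p^2 = 2 a p + 1; the
optimal gain is - b p. *)
Definition riccati (a b : R) := (a + Num.sqrt (a ^+ 2 + b ^+ 2)) / b ^+ 2.

Lemma riccatiE (a b : R) : b != 0 ->
  b ^+ 2 * riccati a b = a + Num.sqrt (a ^+ 2 + b ^+ 2).
Proof. by move=> b0; rewrite /riccati mulrC divfK// sqrf_eq0. Qed.

Lemma riccati_eq (a b : R) : b != 0 ->
  1 + 2 * a * riccati a b = b ^+ 2 * riccati a b ^+ 2.
Proof.
move=> b0; set p := riccati a b.
have : (b ^+ 2 * p - a) ^+ 2 = a ^+ 2 + b ^+ 2.
  by rewrite riccatiE// [a + _]addrC addrK sqr_sqrtr// addr_ge0 ?sqr_ge0.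
have b20 : b ^+ 2 != 0 by rewrite sqrf_eq0.
move=> h; apply: (mulfI b20); lra.
Qed.

Lemma riccati_gt0 (a b : R) : 0 < a -> b != 0 -> 0 < riccati a b.
Proof.
move=> a0 b0; rewrite divr_gt0 ?exprn_even_gt0//.
by rewrite ltr_wpDr ?sqrtr_ge0.
Qed.

Lemma riccati_opt_stable (a b : R) : b != 0 ->
  a + b * (- b * riccati a b) = - Num.sqrt (a ^+ 2 + b ^+ 2).
Proof.
move=> b0.
have -> : b * (- b * riccati a b) = - (b ^+ 2 * riccati a b) by ring.
by rewrite riccatiE// opprD addrA subrr sub0r.
Qed.

(** The excess of the cost of a stabilizing gain [k] over V p is a multiple of
(k + b p)^2, by the Riccati equation. *)
Lemma opt_costE (a b : R) : 0 < a -> b != 0 ->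
  opt_cost a b = (V * (riccati a b)%:E)%E.
Proof.
move=> a0 b0; set p := riccati a b.
have p0 : 0 < p by exact: riccati_gt0.
have q0 : 0 < Num.sqrt (a ^+ 2 + b ^+ 2).
  by rewrite sqrtr_gt0 ltr_pwDl ?exprn_gt0 ?sqr_ge0.
apply/eqP; rewrite eq_le; apply/andP; split.
  apply: ereal_inf_lbound; exists (- b * p) => //.
  have c0 := riccati_opt_stable a b0.
  rewrite cost_linear_stable; last by rewrite c0 oppr_lt0.
  congr (_ * _%:E)%E; rewrite c0 mulrNN; apply/(canLR (mulfK _)).
    by rewrite gt_eqF// mulr_gt0.
  have := riccatiE a b0; have := riccati_eq a b0; rewrite -/p.
  set q := Num.sqrt _ => h1 h2.
  have -> : q = b ^+ 2 * p - a by rewrite h2 [a + q]addrC addrK.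
  by rewrite exprMn sqrrN -h1; lra.
apply: le_ereal_inf_tmp => _ [k _ <-].
have [c0|c0] := leP 0 (a + b * k); first by rewrite cost_linear_unstable// leey.
rewrite cost_linear_stable// lee_wpmul2l ?(ltW normal_second_moment_gt0)//.
rewrite lee_fin ler_pdivlMr; last by rewrite mulNr -mulrN mulr_gt0// oppr_gt0.
rewrite -subr_ge0.
have -> : 1 + k ^+ 2 - p * (- 2 * (a + b * k)) = (k + b * p) ^+ 2.
  by have := riccati_eq a b0; rewrite -/p => h; lra.
exact: sqr_ge0.
Qed.

(** A policy tuned for a gain [b0] degrades slowly when the gain grows, at a rate
that depends on the ratio b / b0 alone; this scale invariance is what makes a
geometric grid of policies suffice. *)
Lemma subopt_ratio (a b0 b s : R) : 0 < a -> 0 < b0 -> b0 <= b -> b <= s * b0 ->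
  (cost a b (linear_policy (- b0 * riccati a b0)) / opt_cost a b <= (s ^+ 2)%:E)%E.
Proof.
move=> a0 b00 b0b bs.
have b_gt0 : 0 < b by exact: lt_le_trans b0b.
have b0n : b0 != 0 by rewrite gt_eqF.
have bn : b != 0 by rewrite gt_eqF.
have := riccatiE a b0n; have := riccatiE a bn; have := riccati_eq a b0n.
have := riccati_gt0 a0 b0n; have := riccati_gt0 a0 bn.
have : Num.sqrt (a ^+ 2 + b0 ^+ 2) <= Num.sqrt (a ^+ 2 + b ^+ 2).
  by rewrite ler_wsqrtr// lerD2l ler_sqr// nnegrE ltW.
have : 0 < Num.sqrt (a ^+ 2 + b0 ^+ 2).
  by rewrite sqrtr_gt0 ltr_pwDl ?exprn_gt0 ?sqr_ge0.
rewrite opt_costE//.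
move: (riccati a b) (riccati a b0) => p p0.
move: (Num.sqrt _) (Num.sqrt _) => q q0 q0_gt0 q0q p_gt0 p0_gt0 h1 h2 h3.
(* The loop closed with the larger gain b is at least as stable as with b0. *)
have cq : q0 <= - (a + b * (- b0 * p0)).
  have -> : - (a + b * (- b0 * p0)) = (b - b0) * b0 * p0 + q0.
    have -> : q0 = b0 ^+ 2 * p0 - a by rewrite h3 [a + q0]addrC addrK.
    ring.
  by rewrite lerDr mulr_ge0 ?(ltW p0_gt0)// mulr_ge0 ?(ltW b00)// subr_ge0.
have c_gt0 := lt_le_trans q0_gt0 cq.
rewrite cost_linear_stable; last by rewrite -oppr_gt0.
have /fineK <- : V \is a fin_num.
  rewrite ge0_fin_numE; first exact: normal_second_moment_lty.
  exact/ltW/normal_second_moment_gt0.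
have v0 : 0 < fine V.
  apply: fine_gt0; apply/andP; split.
    exact: normal_second_moment_gt0.
  exact: normal_second_moment_lty.
move: (fine V) v0 => v v0.
rewrite -!EFinM inver gt_eqF ?mulr_gt0// -EFinM lee_fin.
rewrite ler_pdivrMr ?mulr_gt0// [leRHS]mulrCA ler_wpM2l ?(ltW v0)//.
have hq0 : q0 = b0 ^+ 2 * p0 - a by rewrite h3 [a + q0]addrC addrK.
apply: (@le_trans _ _ p0).
  rewrite mulNr -mulrN ler_pdivrMr ?mulr_gt0//.
  apply: (@le_trans _ _ (p0 * (2 * q0))); last by rewrite !ler_wpM2l// ltW.
  by rewrite exprMn sqrrN -h1 hq0; lra.
rewrite -(@ler_pM2l _ (b0 ^+ 2)) ?exprn_gt0//.
have -> : b0 ^+ 2 * (s ^+ 2 * p) = (s * b0) ^+ 2 * p by ring.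
apply: (@le_trans _ _ (b ^+ 2 * p)); first by rewrite h3 h2 lerD2l.
rewrite ler_wpM2r ?(ltW p_gt0)// ler_sqr// nnegrE ?(ltW b_gt0)//.
by apply: le_trans bs; exact: ltW.
Qed.

End optimal_cost.

(** * Covering the tasks *)

(** The listed policies may repeat, so their number only bounds the size of the
cover that they form. *)
Lemma covering_number_le {R : realType} (a alpha theta : R) (n : nat)
    (p : nat -> R -> R) :
  (forall b, tasks theta b -> exists2 i, (i < n)%N &
     subopt_nbhd a alpha theta (p i) b) ->
  (covering_number a alpha theta <= n%:R%:E)%E.
Proof.
move=> cov; pose C := p @` `I_n.
have [m Cm] : finite_set C by exact: finite_image.
have mn : (m <= n)%N.
  by rewrite -card_le_II -(card_le_eql Cm) card_image_le.
apply: (@le_trans _ _ m%:R%:E); last by rewrite lee_fin ler_nat.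
apply: ereal_inf_lbound; exists m => //; exists C; split => //.
rewrite /subopt_cover; apply/seteqP; split => [b [_ _ []]//|b tb].
have [i ni hi] := cov b tb.
by exists (p i) => //; exists i.
Qed.

Theorem theorem6 (R : realType) (a alpha : R) (ha : 0 < a)
    (halpha : (2 * a + 1) / (2 * a) <= alpha) :
  exists M : R, \forall theta \near +oo,
    (covering_number a alpha theta <= (M * `|ln theta|)%:E)%E.
Proof.
have alpha1 : 1 < alpha.
  apply: lt_le_trans halpha.
  by rewrite ltr_pdivlMr ?mul1r ?mulr_gt0// ltrDl.
(* r is ln s for s = sqrt alpha. *)
pose r := ln alpha / 2.
have r0 : 0 < r by rewrite divr_gt0// ln_gt0.
(* The exponent i.+1 makes grid i the left end of [s^-(i+1), s^-i]: a policy is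
   good to the right of the gain that it is tuned for. *)
pose grid (i : nat) : R := expR (- (r * i.+1%:R)).
exists (r^-1 + 1); near=> theta.
have theta_e : expR 1 <= theta by near: theta; exact: nbhs_pinfty_ge.
have theta0 : 0 < theta by apply: lt_le_trans theta_e; exact: expR_gt0.
have ln1 : 1 <= ln theta by rewrite -[leLHS]expRK ler_ln ?posrE ?expR_gt0.
rewrite ger0_norm ?(le_trans ler01)//.
(* On a logarithmic scale the grid is r-periodic, so b lies between grid i and
   s * grid i for i = index (- ln b). *)
pose index x := Num.truncn (x / r).
apply: (@le_trans _ _ (index (ln theta)).+1%:R%:E); last first.
  rewrite lee_fin -natr1 mulrDl mul1r lerD// mulrC.
  by rewrite truncn_le// divr_ge0 ?ltW// (lt_le_trans ltr01).
apply: (@covering_number_le _ _ _ _ _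
  (fun i => linear_policy (- grid i * riccati a (grid i)))) => b tb.
move: (tb); rewrite /tasks/= in_itv/= => /andP[b_ge b_le].
have b0 : 0 < b by apply: lt_le_trans b_ge; rewrite invr_gt0.
have lnb0 : 0 <= - ln b by rewrite oppr_ge0 ln_le0.
have lnb : - ln b <= ln theta.
  by rewrite lerNl -lnV ?posrE// ler_ln ?posrE ?invr_gt0.
exists (index (- ln b)).
  by rewrite ltnS le_truncn// ler_wpM2r// invr_ge0 ltW.
have /andP[ib bi] := truncn_itv (divr_ge0 lnb0 (ltW r0)).
rewrite -/(index _) in ib bi.
split => //.
have -> : alpha = expR r ^+ 2.
  by rewrite -expRM_natl /r mulrC divfK// lnK ?posrE ?(lt_trans ltr01).
apply: subopt_ratio => //; first exact: expR_gt0.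
- rewrite -{2}(lnK b0) ler_expR lerNl ltW// -ltr_pdivrMl// mulrC//.
- rewrite -expRD -{1}(lnK b0) ler_expR -natr1.
  move: ib; rewrite ler_pdivlMr//; lra.
Unshelve. all: by end_near.
Qed.
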